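(* Let $f(X)=a_{0}+a_{1}X+\cdots+a_{n}X^{n}\in\mathbb{Z}[X]$ with $n\ge 1$ and $a_{0}a_{n}\neq 0$, let $k\geq 2$, and let $p_{1},\dots ,p_{k}$ be pairwise distinct prime numbers. For $i=1,\dots ,k$ let $0=j_{i,1}<j_{i,2}<\cdots<j_{i,r_{i}}=n$ be the abscissae of the vertices of the Newton polygon of $f$ with respect to $p_{i}$, and let $d_{p_{i}}=\gcd(x_{i,1},\dots ,x_{i,r_{i}-1})$, where \[ x_{i,l} = \frac{j_{i,l+1}-j_{i,l}}{\gcd\left(\nu _{p_{i}}(a_{j_{i,l+1}})-\nu _{p_{i}}(a_{j_{i,l}}),\ j_{i,l+1}-j_{i,l}\right)}, \qquad l=1,\dots, r_{i}-1 \] (so $d_{p_{i}}=x_{i,1}=\frac{n}{\gcd(\nu _{p_{i}}(a_{n})-\nu _{p_{i}}(a_{0}),\, n)}$ if $r_{i}=2$). Then the degree of any factor of $f$ is divisible by $n/\gcd\left(\frac{n}{d_{p_{1}}},\dots ,\frac{n}{d_{p_{k}}}\right)$. In particular, if $\gcd\left(\frac{n}{d_{p_{1}}},\dots ,\frac{n}{d_{p_{k}}}\right)=1$, then $f$ is irreducible over $\mathbb{Q}$.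
   Context: For a prime $p$ and a nonzero integer $m$, $\nu_p(m)$ is the largest integer $i$ with $p^i\mid m$; $\nu_p(0)=\infty$. For $f(X)=\sum_{i=0}^n a_iX^i\in\mathbb{Z}[X]$ with $a_0a_n\neq 0$, the Newton polygon of $f$ with respect to $p$ is the lower convex hull of the points $(i,\nu_p(a_i))$, $0\le i\le n$, $a_i\neq 0$: a broken line from $(0,\nu_p(a_0))$ to $(n,\nu_p(a_n))$. Its vertices are its corner points together with its two end-points; consecutive vertices are joined by edges, and the slopes of the edges strictly increase from left to right. The greatest common divisor is taken to be positive, with $\gcd(0,m)=m$ for $m>0$. *)

(* Defs.v *)
From HB Require Import structures.
From mathcomp Require Import all_boot all_order all_algebra.

Set Implicit Arguments.
Unset Strict Implicit.
Unset Printing Implicit Defensive.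

Import Order.TTheory GRing.Theory Num.Theory.
Local Open Scope ring_scope.

(* [nu p 0] is 0 instead of infinity; below, [nu] only matters at nonzero
   coefficients. *)
Definition nu (p : nat) (a : int) : nat := logn p `|a|%N.

(* Convex hull of the points (i, nu p f`_i) with f`_i != 0. All the data being
   rational, rational coordinates and weights give the same polygon and the
   same vertices as real ones. *)
Definition newton_hull (p : nat) (f : {poly int}) (x y : rat) : Prop :=
  exists w : nat -> rat,
    [/\ forall i, 0 <= w i,
        forall i, f`_i = 0 -> w i = 0,
        \sum_(i < size f) w i = 1,
        x = \sum_(i < size f) w i * i%:R
      & y = \sum_(i < size f) w i * (nu p f`_i)%:R].

Definition newton_polygon (p : nat) (f : {poly int}) (x y : rat) : Prop :=
  newton_hull p f x y /\ (forall z, newton_hull p f x z -> y <= z).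

(* The broken line is not straight across (x, y): (x, y) is never collinear with
   a point of the line on its left and a point of the line on its right. *)
Definition newton_corner (p : nat) (f : {poly int}) (x y : rat) : Prop :=
  newton_polygon p f x y /\
  (forall x1 y1 x2 y2,
     newton_polygon p f x1 y1 -> newton_polygon p f x2 y2 ->
     x1 < x -> x < x2 ->
     (y - y1) / (x - x1) <> (y2 - y) / (x2 - x)).

Definition newton_vertex (p : nat) (f : {poly int}) (x y : rat) : Prop :=
  newton_polygon p f x y /\
  [\/ x = 0, x = (size f).-1%:R | newton_corner p f x y].

(* Vertices are among the points spanning the hull, so their abscissae are
   natural numbers. *)
Definition newton_abscissae (p : nat) (f : {poly int}) (s : seq nat) : Prop :=
  sorted ltn s /\
  (forall j : nat, j \in s <-> exists y : rat, newton_vertex p f j%:R y).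

Definition edge_width (p : nat) (f : {poly int}) (j j' : nat) : nat :=
  ((j' - j) %/ gcdn `|(nu p f`_j')%:Z - (nu p f`_j)%:Z| (j' - j))%N.

(* With 0-based indexing, the edges of s = [:: s_0; ...; s_(r-1)] join s_l to
   s_(l+1) for l < r - 1. *)
Definition edge_gcd (p : nat) (f : {poly int}) (s : seq nat) : nat :=
  \big[gcdn/0%N]_(0 <= l < (size s).-1)
     edge_width p f (nth 0%N s l) (nth 0%N s l.+1).

Lemma edge_gcd_one_edge (p : nat) (f : {poly int}) (n : nat) :
  edge_gcd p f [:: 0%N; n] =
  (n %/ gcdn `|(nu p f`_n)%:Z - (nu p f`_0)%:Z| n)%N.
Proof. by rewrite /edge_gcd big_nat1 /edge_width /= subn0. Qed.

(* Main.v *)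
(* For each prime p = p_i, the degree of any factor g of f is divisible by d_p.
   If c f = g h, then for every slope lam the face of slope lam of the Newton
   polygon of c f is the sum of those of g and h (Gauss's lemma for the
   valuation min_i (nu_p(a_i) - lam i)). A face of g whose slope is that of an
   edge of f of reduced width x has width divisible by x, because the slope has
   denominator x and nu_p is integral. Following the edges of f from left to
   right, the corresponding faces of g fill up [0, deg g], so that d_p divides
   deg g. Hence deg g is a multiple of lcm_i d_(p_i) = n / gcd_i (n / d_(p_i)). *)

Require Import Defs.
From HB Require Import structures.
From mathcomp Require Import all_boot all_order all_algebra.
From mathcomp Require Import ring lra zify.

Set Implicit Arguments.
Unset Strict Implicit.
Unset Printing Implicit Defensive.

Import Order.TTheory GRing.Theory Num.Theory.
Local Open Scope ring_scope.

(** * Valuations of products and sums of integers *)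

Lemma coef_neq0_lt (R : nzSemiRingType) (g : {poly R}) i :
  g`_i != 0 -> (i < size g)%N.
Proof.
by rewrite ltnNge; apply: contra => /leq_sizeP/(_ i (leqnn i)) ->.
Qed.

Lemma nuM p a b : a != 0 -> b != 0 -> nu p (a * b) = (nu p a + nu p b)%N.
Proof. by move=> a0 b0; rewrite /nu abszM lognM // absz_gt0. Qed.

Lemma dvdz_exp_nu p e z : prime p -> z != 0 ->
  ((p ^ e)%:Z %| z)%Z = (e <= nu p z)%N.
Proof. by move=> pp z0; rewrite dvdzE absz_nat pfactor_dvdn // absz_gt0. Qed.

(** Otherwise [p ^ (nu p S).+1] would divide every term, hence the sum [S]. Zero terms are set apart
    because [nu p 0] is 0. *)
Lemma nu_sum_ge p (I : finType) (P : pred I) (F : I -> int) : prime p ->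
  \sum_(i | P i) F i != 0 ->
  exists i, [/\ P i, F i != 0 & (nu p (F i) <= nu p (\sum_(i | P i) F i)%R)%N].
Proof.
move=> pp S0; set S := \sum_(i | P i) F i in S0 *.
case: (pickP (fun i => [&& P i, F i != 0 & nu p (F i) <= nu p S]%N)).
  by move=> i /and3P[]; exists i.
move=> none; have: ((p ^ (nu p S).+1)%:Z %| S)%Z.
  apply: rpred_sum => i Pi; have := none i; rewrite Pi /=.
  have [->|Fi0] := eqVneq (F i) 0; first by rewrite dvdz0.
  by rewrite dvdz_exp_nu //= ltnNge => ->.
by rewrite dvdz_exp_nu // ltnn.
Qed.

(** * Faces of a given slope and Gauss's lemma *)

(** Height at which the line of slope [lam] through the [i]-th point meets the vertical axis; among
    the points with nonzero coefficient it is least on the face of slope [lam]. *)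
Definition wt p (g : {poly int}) (lam : rat) (i : nat) : rat :=
  (nu p g`_i)%:R - lam * i%:R.

(* For [sg = 1] (resp. [sg = -1]), [a] is the left (resp. right) end of the face
   of slope [lam] of the Newton polygon of [g]. *)
Definition extremal p (sg lam : rat) (g : {poly int}) (a : nat) : Prop :=
  g`_a != 0 /\
  forall i, g`_i != 0 -> i != a ->
    wt p g lam a < wt p g lam i \/
    (wt p g lam a = wt p g lam i /\ sg * a%:R < sg * i%:R).

Lemma extremal_uniq p sg lam g a b :
  extremal p sg lam g a -> extremal p sg lam g b -> a = b.
Proof.
move=> [a0 Ha] [b0 Hb]; apply/eqP/negPn/negP => ab.
have := Ha b b0; rewrite eq_sym => /(_ ab); have := Hb a a0 ab.
by move=> [?|[? ?]] [?|[? ?]]; lra.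
Qed.

Lemma extremal_le p sg lam g a i :
  extremal p sg lam g a -> g`_i != 0 -> wt p g lam a <= wt p g lam i.
Proof.
move=> [a0 Ha] i0; have [->//|ia] := eqVneq i a.
by case: (Ha i i0 ia) => [/ltW|[-> _]].
Qed.

Lemma extremal_exists p sg lam g :
  sg != 0 -> g != 0 -> exists a, extremal p sg lam g a.
Proof.
move=> sg0 g0.
have szg : (0 < size g)%N by rewrite size_poly_gt0.
have last_lt : ((size g).-1 < size g)%N by rewrite prednK.
pose P (i : 'I_(size g)) := g`_i != 0.
have P0 : P (Ordinal last_lt) by rewrite /P /= -lead_coefE lead_coef_eq0.
case: (arg_minP (fun i : 'I__ => wt p g lam i) P0) => a0 Pa0 min0.
pose Q i := P i && (wt p g lam i == wt p g lam a0).
have Q0 : Q a0 by rewrite /Q Pa0 eqxx.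
case: (arg_minP (fun i : 'I__ => sg * i%:R) Q0) => a /andP[Pa /eqP wa] mina.
exists a; split=> // i i0 ia; rewrite wa.
have := min0 (Ordinal (coef_neq0_lt i0)) i0.
rewrite le_eqVlt => /orP[/eqP /= e|]; last by left.
right; split=> //; rewrite lt_neqAle.
have -> : sg * a%:R <= sg * i%:R.
  by apply: (mina (Ordinal (coef_neq0_lt i0))); rewrite /Q /P /= i0 -e eqxx.
rewrite andbT; apply: contra ia => /eqP/(mulfI sg0)/eqP.
by rewrite eqr_nat eq_sym.
Qed.

(** Among the pairs of indices with sum [a + b], only (a, b) attains the weight [W]: a tie would
    have to be broken by [sg], but the sums agree. For another sum [m], some product of valuation at
    most that of the coefficient bounds its weight below by [W], and [sg] breaks ties in favour of
    [a + b]. *)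
Lemma extremalM p sg lam g h a b : prime p ->
  extremal p sg lam g a -> extremal p sg lam h b ->
  extremal p sg lam (g * h) (a + b).
Proof.
move=> pp [a0 Ha] [b0 Hb].
set W := wt p g lam a + wt p h lam b.
have nuE i j : g`_i * h`_j != 0 ->
    (nu p (g`_i * h`_j))%:R - lam * (i + j)%:R = wt p g lam i + wt p h lam j.
  rewrite mulf_eq0 negb_or => /andP[i0 j0].
  by rewrite nuM // /wt !natrD; ring.
have term i j : g`_i * h`_j != 0 -> ~~ ((i == a) && (j == b)) ->
    W < wt p g lam i + wt p h lam j \/
    (W = wt p g lam i + wt p h lam j /\ sg * (a + b)%:R < sg * (i + j)%:R).
  rewrite mulf_eq0 !negb_or negb_and => /andP[i0 j0] ij; rewrite /W !natrD.
  have [ia|ia] := eqVneq i a; have [jb|jb] := eqVneq j b.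
  - by rewrite ia jb !eqxx in ij.
  - by rewrite ia; case: (Hb j j0 jb) => [|[]] *; [left|right]; lra.
  - by rewrite jb; case: (Ha i i0 ia) => [|[]] *; [left|right]; lra.
  - by case: (Ha i i0 ia) => [|[]] *; case: (Hb j j0 jb) => [|[]] *;
      [left|left|left|right]; lra.
have T0 : g`_a * h`_b != 0 by rewrite mulf_neq0.
have a_lt : (a < (a + b).+1)%N by rewrite ltnS leq_addr.
(* This yields both that the coefficient is nonzero and that its weight is at most [W]. *)
have Tab : ~~ ((p ^ (nu p (g`_a * h`_b)).+1)%:Z %| (g * h)`_(a + b))%Z.
  rewrite coefM (bigD1 (Ordinal a_lt)) //= addKn rpredDr.
    by rewrite dvdz_exp_nu // ltnn.
  apply: rpred_sum => i ia; have {}ia : (i != a :> nat) by [].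
  have [->|F0] := eqVneq (g`_i * h`_(a + b - i)) 0; first by rewrite dvdz0.
  have ile : (i <= a + b)%N by rewrite -ltnS ltn_ord.
  rewrite /= dvdz_exp_nu // -(ltr_nat rat).
  have := term _ _ F0; rewrite (negPf ia) => /(_ isT).
  rewrite /W -nuE // -nuE // subnKC //.
  by case=> [?|[_ ?]]; lra.
have S0 : (g * h)`_(a + b) != 0.
  by apply: contraNneq Tab => ->; rewrite dvdz0.
have SW : wt p (g * h) lam (a + b) <= W.
  rewrite /W -nuE // /wt lerB // ler_nat leqNgt.
  by move: Tab; rewrite dvdz_exp_nu.
split=> // m m0 mab.
have [i [_ F0 le_nu]] : exists i : 'I_m.+1, [/\ true, g`_i * h`_(m - i) != 0
    & (nu p (g`_i * h`_(m - i)) <= nu p (g * h)`_m)%N].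
  by rewrite coefM; apply: nu_sum_ge => //; rewrite -coefM.
have im : (i <= m)%N by rewrite -ltnS ltn_ord.
have ge : wt p g lam i + wt p h lam (m - i) <= wt p (g * h) lam m.
  by rewrite -nuE // subnKC // /wt lerB // ler_nat.
have := term _ _ F0; rewrite subnKC // => H.
have {}/H : ~~ ((i == a :> nat) && (m - i == b)%N).
  by apply: contra mab => /andP[/eqP <- /eqP <-]; rewrite subnKC.
case=> [lt|[e lt]]; first by left; lra.
have [?|?] := ltrP (wt p (g * h) lam (a + b)) (wt p (g * h) lam m); first by left.
by right; split=> //; lra.
Qed.

(** The sum of the two minimality inequalities is (lam' - lam) (b - a) >= 0. *)
Lemma extremal_mono p lam lam' g a b :
  extremal p (-1) lam g a -> extremal p 1 lam' g b -> lam < lam' -> (a <= b)%N.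
Proof.
move=> Ha Hb ll; rewrite leqNgt; apply/negP => ba.
have := extremal_le Ha (proj1 Hb); have := extremal_le Hb (proj1 Ha).
rewrite /wt; move: ba; rewrite -(ltr_nat rat) => ba.
by nra.
Qed.

Lemma extremal_wt_eq p lam g a b :
  extremal p 1 lam g a -> extremal p (-1) lam g b ->
  (nu p g`_b)%:R - (nu p g`_a)%:R = lam * (b%:R - a%:R).
Proof.
move=> Ha Hb; have := extremal_le Ha (proj1 Hb).
by have := extremal_le Hb (proj1 Ha); rewrite /wt; lra.
Qed.

(** * Vertices as right ends of faces, and the chain of faces *)

(** The face of slope [mu] may reduce to a point, so that the abscissa 0 also qualifies. *)
Definition right_vertex p (f : {poly int}) (j : nat) : Prop :=
  exists mu, extremal p (-1) mu f j.

Lemma right_vertex0 p (f : {poly int}) : f`_0 != 0 -> right_vertex p f 0.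
Proof.
(* So steep a descent gives every index [i >= 1] a weight above that of 0. *)
move=> f0; exists (- (nu p f`_0).+1%:R); split=> // i fi i0; left.
rewrite /wt mulr0 subr0 -natr1.
have : (1 : rat) <= i%:R by rewrite ler1n lt0n.
have : (0 : rat) <= (nu p f`_i)%:R by [].
have : (0 : rat) <= (nu p f`_0)%:R by [].
by nra.
Qed.

(** Gift wrapping: [lam] is the least slope from the point at [m] to a point on its right, and [m']
    is the right end of the face of that slope. *)
Lemma next_face p (f : {poly int}) m : right_vertex p f m -> (m < (size f).-1)%N ->
  exists lam m', [/\ (m < m')%N, extremal p 1 lam f m
                   & extremal p (-1) lam f m'].
Proof.
move=> [mu Hm] ltm; have [fm0 Hmu] := Hm.
have szf : (0 < size f)%N by case: (size f) ltm.
have last_lt : ((size f).-1 < size f)%N by rewrite prednK.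
pose P (i : 'I_(size f)) := (f`_i != 0) && (m < i)%N.
have P0 : P (Ordinal last_lt).
  by rewrite /P /= -lead_coefE lead_coef_eq0 -size_poly_gt0 szf.
pose slope i : rat := ((nu p f`_i)%:R - (nu p f`_m)%:R) / (i%:R - m%:R).
case: (arg_minP (fun i : 'I__ => slope i) P0) => i0 /andP[fi0 mi0] mini.
set lam := slope i0 in mini.
have posd i : (m < i)%N -> 0 < i%:R - m%:R :> rat.
  by move=> ?; rewrite subr_gt0 ltr_nat.
have wi0 : wt p f lam m = wt p f lam i0.
  have : lam * (i0%:R - m%:R) = (nu p f`_i0)%:R - (nu p f`_m)%:R.
    by rewrite divfK // gt_eqF // posd.
  by rewrite /wt; lra.
(* Strict, since points to the right of [m] have strictly larger weight for [mu]. Points on the left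
   then gain weight relative to [m] when [mu] is replaced by [lam]. *)
have mulam : mu < lam.
  have mr := posd _ mi0; have := Hmu i0 fi0; rewrite (gtn_eqF mi0) => /(_ isT).
  rewrite /wt in wi0 *; case=> [h|[_ h]]; last by lra.
  rewrite -subr_gt0 -(pmulr_lgt0 _ mr); lra.
have wgt i : f`_i != 0 -> (m < i)%N -> wt p f lam m <= wt p f lam i.
  move=> fi mi; have := mini (Ordinal (coef_neq0_lt fi)).
  by rewrite /P /= fi mi /slope => /(_ isT); rewrite ler_pdivlMr ?posd // /wt; lra.
have wlt i : f`_i != 0 -> (i < m)%N -> wt p f lam m < wt p f lam i.
  move=> fi im; have := extremal_le Hm fi; rewrite /wt.
  by move: im; rewrite -(ltr_nat rat); nra.
have [m' Hm'] := @extremal_exists p (-1) lam f isT (ltac:(by rewrite -size_poly_gt0)).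
have m'm := extremal_le Hm' fm0; have [fm'0 _] := Hm'.
have mm' : (m < m')%N.
  case: (ltngtP m' m) => // [lt|e]; first by have := wlt _ fm'0 lt; lra.
  case: Hm' => _ /(_ i0 fi0); rewrite e (gtn_eqF mi0) => /(_ isT).
  by move: mi0; rewrite -(ltr_nat rat) => ?; case=> [|[_]]; lra.
exists lam, m'; split=> //; split=> // i fi; case: ltngtP => // im _.
  by left; apply: wlt.
have := wgt i fi im; rewrite le_eqVlt => /orP[/eqP|]; [right|by left].
by split=> //; move: im; rewrite -(ltr_nat rat); lra.
Qed.

(** Walk along the faces: the half-open intervals (m, m'] tile, and when [j] reaches [m'] the next
    face starts there. *)
Lemma face_cover p (f : {poly int}) j : f`_0 != 0 -> (0 < j <= (size f).-1)%N ->
  exists lam m m', [/\ (m < j <= m')%N, right_vertex p f m,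
    extremal p 1 lam f m & extremal p (-1) lam f m'].
Proof.
move=> f0; elim: j => [//|j IHj] /= jn.
case: j => [|j] in IHj jn *.
  have [lam [m' [? ? ?]]] := next_face (right_vertex0 p f0) jn.
  by exists lam, 0%N, m'; split=> //; apply: right_vertex0.
have [lam [m [m' [/andP[mj jm'] Hm H1 H2]]]] := IHj (ltnW jn).
have [jj|jj] := ltnP j.+1 m'.
  by exists lam, m, m'; split=> //; rewrite (ltn_trans mj).
have e : m' = j.+1 by apply/eqP; rewrite eqn_leq jj jm'.
have vj : right_vertex p f j.+1 by rewrite -e; exists lam.
have [lam' [m'' [? ? ?]]] := next_face vj jn.
by exists lam', j.+1, m''; split=> //; apply/andP.
Qed.

(** The point at [j] lies on or above the chord. If [lam <= mu], comparison with [m'] contradicts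
    that [j] is a right end for [mu]; if [mu < lam], comparison with [m] does. *)
Lemma right_vertex_face_gap p f lam m m' j :
  extremal p 1 lam f m -> extremal p (-1) lam f m' ->
  right_vertex p f j -> ~~ (m < j < m')%N.
Proof.
move=> Hm Hm' [mu [fj Hj]]; apply/negP => /andP[mj jm'].
have := Hj m (proj1 Hm); rewrite (ltn_eqF mj) => /(_ isT).
have := Hj m' (proj1 Hm'); rewrite (gtn_eqF jm') => /(_ isT).
have := extremal_le Hm fj; have := extremal_wt_eq Hm Hm'; rewrite /wt.
move: mj jm'; rewrite -!(ltr_nat rat) => mj jm' e le H1 H2.
have {}H1 : (nu p f`_j)%:R - mu * j%:R < (nu p f`_m')%:R - mu * m'%:R by lra.
have {}H2 : (nu p f`_j)%:R - mu * j%:R <= (nu p f`_m)%:R - mu * m%:R by lra.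
have [lm|ml] := lerP lam mu.
  have : 0 <= (mu - lam) * (m'%:R - j%:R) by rewrite mulr_ge0 // subr_ge0 // ltW.
  lra.
have : 0 < (lam - mu) * (j%:R - m%:R) by rewrite mulr_gt0 // subr_gt0.
lra.
Qed.

Lemma right_vertex_size p (f : {poly int}) : f`_0 != 0 -> (0 < (size f).-1)%N ->
  right_vertex p f (size f).-1.
Proof.
move=> f0 n0; have n01 : (0 < (size f).-1 <= (size f).-1)%N by rewrite n0 leqnn.
have [lam [m [m' [/andP[_ le] _ _ H]]]] := face_cover p f0 n01.
suff <- : m' = (size f).-1 by exists lam.
apply/eqP; rewrite eqn_leq le andbT; case: H => /coef_neq0_lt + _.
by case: (size f).
Qed.

(** * Agreement with the vertices defined by the convex hull *)

Lemma newton_hull_segment p (f : {poly int}) m m' t : f`_m != 0 -> f`_m' != 0 -> 0 <= t <= 1 ->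
  newton_hull p f (t * m%:R + (1 - t) * m'%:R)
    (t * (nu p f`_m)%:R + (1 - t) * (nu p f`_m')%:R).
Proof.
move=> fm fm' /andP[t0 t1].
(* A sum of two indicators, so that [m = m'] is allowed. *)
pose w i : rat := t * (i == m)%:R + (1 - t) * (i == m')%:R.
have sumE (F : nat -> rat) : \sum_(i < size f) w i * F i = t * F m + (1 - t) * F m'.
  have one k : f`_k != 0 -> \sum_(i < size f) (i == k :> nat)%:R * F i = F k.
    move=> fk; rewrite (bigD1 (Ordinal (coef_neq0_lt fk))) //= eqxx mul1r big1 ?addr0 //.
    by move=> i; rewrite -val_eqE /= => /negPf ->; rewrite mul0r.
  rewrite -(one m fm) -(one m' fm') !mulr_sumr -big_split /=.
  by apply: eq_bigr => i _; rewrite /w; ring.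
exists w; split.
- by move=> i; rewrite /w addr_ge0 // mulr_ge0 // subr_ge0.
- move=> i fi; rewrite /w; have [e|_] := eqVneq i m; first by rewrite -e fi eqxx in fm.
  by have [e|_] := eqVneq i m'; [rewrite -e fi eqxx in fm' | rewrite !mulr0 addr0].
- by have := sumE (fun=> 1); under eq_bigr do rewrite mulr1; move=> ->; ring.
- by rewrite sumE.
- by rewrite (sumE (fun i => (nu p f`_i)%:R)).
Qed.

(** The horizontal offset from [j] and the height above the line of slope [lam] through the point at
    [j] are averages with the same weights, so signs can be read off termwise. *)
Lemma newton_hull_wt p f lam j x y : newton_hull p f x y ->
  exists w : nat -> rat, [/\ forall i, 0 <= w i, forall i, f`_i = 0 -> w i = 0,
    x - j%:R = \sum_(i < size f) w i * (i%:R - j%:R)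
  & y - ((nu p f`_j)%:R + lam * (x - j%:R)) =
      \sum_(i < size f) w i * (wt p f lam i - wt p f lam j)].
Proof.
move=> [w [w0 wf w1 -> ->]]; exists w; split=> //.
  by under [RHS]eq_bigr do rewrite mulrBr; rewrite sumrB -mulr_suml w1 mul1r.
under [RHS]eq_bigr do rewrite mulrBr; rewrite sumrB -mulr_suml w1 mul1r.
have -> : \sum_(i < size f) w i * wt p f lam i =
    \sum_(i < size f) w i * (nu p f`_i)%:R - lam * \sum_(i < size f) w i * i%:R.
  by rewrite mulr_sumr -sumrB; apply: eq_bigr => i _; rewrite /wt; ring.
by rewrite /wt; ring.
Qed.

Lemma newton_hull_ge p f sg lam j x y :
  extremal p sg lam f j -> newton_hull p f x y ->
  (nu p f`_j)%:R + lam * (x - j%:R) <= y.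
Proof.
move=> Hj /(newton_hull_wt lam j)[w [w0 wf _ e]].
rewrite -subr_ge0 e; apply: sumr_ge0 => i _.
have [/wf->|fi] := eqVneq f`_i 0; first by rewrite mul0r.
by rewrite mulr_ge0 // subr_ge0 (extremal_le Hj).
Qed.

(** On the supporting line, only indices of minimal weight contribute; these are at most [j], a
    right end, which forces [x <= j]. *)
Lemma newton_hull_gt p f lam j x y :
  extremal p (-1) lam f j -> newton_hull p f x y -> j%:R < x ->
  (nu p f`_j)%:R + lam * (x - j%:R) < y.
Proof.
move=> Hj hxy jx; rewrite lt_neqAle (newton_hull_ge Hj hxy) andbT.
apply: contraTneq jx => e0; have [w [w0 wf ex ey]] := newton_hull_wt lam j hxy.
rewrite -leNgt -subr_le0 ex; apply: sumr_le0 => i _.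
have term_ge0 (k : 'I_(size f)) : true -> 0 <= w k * (wt p f lam k - wt p f lam j).
  have [/wf->|fk] := eqVneq f`_k 0; first by rewrite mul0r.
  by rewrite mulr_ge0 // subr_ge0 (extremal_le Hj).
have := psumr_eq0P term_ge0; rewrite -ey -e0 subrr => /(_ erefl i isT)/eqP.
rewrite mulf_eq0 subr_eq0 => /orP[/eqP->|/eqP wij]; first by rewrite mul0r.
have [/wf->|fi] := eqVneq f`_i 0; first by rewrite mul0r.
apply: mulr_ge0_le0 => //; rewrite subr_le0.
have [->//|ij] := eqVneq (i : nat) j.
by case: (proj2 Hj i fi ij) => [|[_]]; lra.
Qed.

Lemma right_vertex_polygon p f j :
  right_vertex p f j -> newton_polygon p f j%:R (nu p f`_j)%:R.
Proof.
move=> [mu Hj]; split.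
  have := @newton_hull_segment p f j j 1 (proj1 Hj) (proj1 Hj) isT.
  by rewrite subrr !mul1r !mul0r !addr0.
by move=> z /(newton_hull_ge Hj); rewrite subrr mulr0 addr0.
Qed.

Lemma right_vertex_newton p f j :
  right_vertex p f j -> newton_vertex p f j%:R (nu p f`_j)%:R.
Proof.
move=> vj; split; first exact: right_vertex_polygon.
(* The slope [mu] separates the slopes on the left from those on the right. At the end-points one
   side is empty, so the corner condition holds there too. *)
apply: Or33; split; first exact: right_vertex_polygon.
have [mu Hj] := vj => x1 y1 x2 y2 [h1 _] [h2 _] lt1 lt2.
have := newton_hull_ge Hj h1; have := newton_hull_gt Hj h2 lt2 => gt2 ge1.
apply/eqP; rewrite lt_eqF //; apply: (@le_lt_trans _ _ mu).
  by rewrite ler_pdivrMr ?subr_gt0 //; lra.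
by rewrite ltr_pdivlMr ?subr_gt0 //; lra.
Qed.

(** An inner [j] lies in (m, m'] for some face. If [j < m'], the chord bounds [y] above and the
    supporting line bounds it below, so the point is collinear with both ends and is no corner. *)
Lemma newton_vertex_right p (f : {poly int}) j y : f`_0 != 0 -> (0 < (size f).-1)%N ->
  newton_vertex p f j%:R y -> right_vertex p f j.
Proof.
move=> f0 n0 [[hjy ymin] jcases].
have [->|j0] := posnP j; first exact: right_vertex0.
have [->|jn] := eqVneq j (size f).-1; first exact: right_vertex_size.
case: jcases => [/eqP|/eqP|[_ corner]].
- by rewrite pnatr_eq0 (gtn_eqF j0).
- by rewrite eqr_nat (negPf jn).
have jle : (0 < j <= (size f).-1)%N.
  rewrite j0 -(ler_nat rat).
  case: hjy => w [w0 _ w1 -> _]; rewrite -[leRHS]mul1r -[X in X * _]w1 mulr_suml.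
  apply: ler_sum => i _; rewrite ler_wpM2l // ler_nat.
  by rewrite -ltnS prednK ?ltn_ord //; case: (size f) n0.
have [lam [m [m' [/andP[mj jm'] vm Hm Hm']]]] := face_cover p f0 jle.
have vm' : right_vertex p f m' by exists lam.
have [->//|jm'_neq] := eqVneq j m'.
have {jm'_neq} jm' : (j < m')%N by rewrite ltn_neqAle jm'_neq.
have e := extremal_wt_eq Hm Hm'.
move: mj jm'; rewrite -!(ltr_nat rat) => mj jm'.
have d0 : 0 < m'%:R - m%:R :> rat by rewrite subr_gt0 (lt_trans mj).
pose t : rat := (m'%:R - j%:R) / (m'%:R - m%:R).
have tE : t * (m'%:R - m%:R) = m'%:R - j%:R by rewrite divfK ?gt_eqF.
have t01 : 0 <= t <= 1.
  by rewrite divr_ge0 ?ler_pdivrMr ?mul1r //; lra.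
have := newton_hull_segment p (proj1 Hm) (proj1 Hm') t01.
have -> : t * m%:R + (1 - t) * m'%:R = j%:R :> rat.
  by transitivity (m'%:R - t * (m'%:R - m%:R)); [ring | rewrite tE; ring].
move=> /ymin; have := newton_hull_ge Hm hjy => yge yle.
have {}yle : y <= (nu p f`_m)%:R + lam * (j%:R - m%:R).
  apply: (le_trans yle); rewrite le_eqVlt; apply/orP; left; apply/eqP.
  transitivity ((nu p f`_m')%:R - t * ((nu p f`_m')%:R - (nu p f`_m)%:R)); first by ring.
  by rewrite e mulrCA tE -[(nu p f`_m')%:R](subrK (nu p f`_m)%:R) e; ring.
have yE : y = (nu p f`_m)%:R + lam * (j%:R - m%:R) by apply/eqP; rewrite eq_le yle yge.
have := corner _ _ _ _ (right_vertex_polygon vm) (right_vertex_polygon vm') mj jm'.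
case; rewrite -[(nu p f`_m')%:R](subrK (nu p f`_m)%:R) e yE.
transitivity lam.
  by apply: (canLR (mulfK _)); [rewrite subr_eq0 gt_eqF | ring].
by apply: (canRL (mulfK _)); [rewrite subr_eq0 gt_eqF | ring].
Qed.

Lemma mem_newton_abscissae p (f : {poly int}) s j : f`_0 != 0 -> (0 < (size f).-1)%N ->
  newton_abscissae p f s -> (j \in s) <-> right_vertex p f j.
Proof.
move=> f0 n0 [_ sP]; rewrite sP; split=> [[y]|vj].
  exact: newton_vertex_right.
by exists (nu p f`_j)%:R; apply: right_vertex_newton.
Qed.

(** The face leaving the [l]-th entry ends at a listed abscissa; were it not the next one, the next
    one would lie strictly inside the face. *)
Lemma newton_abscissae_face p (f : {poly int}) s l :
  f`_0 != 0 -> (0 < (size f).-1)%N ->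
  newton_abscissae p f s -> (l.+1 < size s)%N ->
  [/\ (nth 0%N s l < nth 0%N s l.+1)%N & exists lam,
    extremal p 1 lam f (nth 0%N s l) /\ extremal p (-1) lam f (nth 0%N s l.+1)].
Proof.
move=> f0 n0 sP lt; have memP j := mem_newton_abscissae j f0 n0 sP.
have [srt _] := sP.
have nth_lt i k : (k < size s)%N -> (i < k)%N -> (nth 0%N s i < nth 0%N s k)%N.
  move=> ks ik; apply: (sorted_ltn_nth ltn_trans) => //.
  by rewrite inE (ltn_trans ik).
have ltss := nth_lt _ _ lt (leqnn _); split=> //.
have vl : right_vertex p f (nth 0%N s l) by apply/memP/mem_nth/ltnW.
have vl1 : right_vertex p f (nth 0%N s l.+1) by apply/memP/mem_nth.
have lln : (nth 0%N s l < (size f).-1)%N.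
  apply: (leq_trans ltss); case: vl1 => mu [/coef_neq0_lt + _].
  by case: (size f).
have [lam [m' [ltm H1 H2]]] := next_face vl lln.
exists lam; split=> //; suff -> : nth 0%N s l.+1 = m' by [].
have /memP /(nthP 0%N)[i ilt im] : right_vertex p f m' by exists lam.
have li : (l < i)%N.
  rewrite ltnNge leq_eqVlt; apply/negP => /orP[/eqP il|il].
    by rewrite -im il ltnn in ltm.
  by have := nth_lt _ _ (ltnW lt) il; rewrite im; lia.
have [il1|il1] := eqVneq i l.+1; first by rewrite -im il1.
have := right_vertex_face_gap H1 H2 vl1; rewrite ltss /=.
by rewrite -im nth_lt //; lia.
Qed.

(** * Divisibility of face widths and of degrees of factors *)

Lemma face_width_dvd p f g lam u v a b : (u < v)%N ->
  extremal p 1 lam f u -> extremal p (-1) lam f v ->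
  extremal p 1 lam g a -> extremal p (-1) lam g b ->
  (a <= b)%N /\ (edge_width p f u v %| b - a)%N.
Proof.
move=> uv Hu Hv Ha Hb.
have eab := extremal_wt_eq Ha Hb; have euv := extremal_wt_eq Hu Hv.
have ab : (a <= b)%N.
  have [->//|ab] := eqVneq a b.
  have := proj2 Ha b (proj1 Hb); rewrite eq_sym => /(_ ab).
  rewrite /wt -(ler_nat rat); case=> [|[_]]; lra.
split=> //; rewrite /edge_width.
set N := (nu p f`_v)%:Z - _; set w := (v - u)%N.
pose M := (nu p g`_b)%:Z - (nu p g`_a)%:Z.
(* Both faces have slope [lam]; cross-multiplying avoids dividing by [b - a], which may be 0. *)
have eMN : (`|M| * w = `|N| * (b - a))%N.
  rewrite -[w]absz_nat -[(b - a)%N]absz_nat -!abszM; congr absz.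
  apply: (@intr_inj rat); rewrite !rmorphM !rmorphB /=.
  rewrite /w -!subzn ?(ltnW uv) // !rmorphB /= -!pmulrn.
  by rewrite eab euv; ring.
have w0 : (0 < w)%N by rewrite subn_gt0.
set G := gcdn _ _; have G0 : (0 < G)%N by rewrite gcdn_gt0 w0 orbT.
have co : coprime (w %/ G) (`|N| %/ G).
  by rewrite /coprime -(eqn_pmul2r G0) muln_gcdl !divnK ?dvdn_gcdl ?dvdn_gcdr // mul1n gcdnC.
rewrite -(Gauss_dvdr _ co); apply/dvdnP; exists `|M|%N.
apply/eqP; rewrite -(eqn_pmul2r G0) -[X in _ == X]mulnA divnK ?dvdn_gcdr //.
by rewrite mulnAC divnK ?dvdn_gcdl // eMN.
Qed.

(** The constant [c] has its only face at index 0, so [c%:P * f] and [f] have the same face ends;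
    uniqueness then identifies [v] with [a + b]. *)
Lemma extremal_split p sg lam c f g h v : prime p -> sg != 0 -> c != 0 ->
  c%:P * f = g * h -> extremal p sg lam f v ->
  exists a b, [/\ extremal p sg lam g a, extremal p sg lam h b & (a + b)%N = v].
Proof.
move=> pp sg0 c0 cfgh Hv.
have f0 : f != 0 by apply: contraTneq (proj1 Hv) => ->; rewrite coef0 eqxx.
have : g * h != 0 by rewrite -cfgh mulf_neq0 // polyC_eq0.
rewrite mulf_eq0 negb_or => /andP[g0 h0].
have [a Ha] := extremal_exists p lam sg0 g0.
have [b Hb] := extremal_exists p lam sg0 h0.
have Hc : extremal p sg lam c%:P 0.
  split=> [|i]; first by rewrite coefC.
  by rewrite coefC; have [->|_] := eqVneq i 0%N; rewrite ?eqxx.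
exists a, b; split=> //; apply: (extremal_uniq (extremalM pp Ha Hb)).
by rewrite -cfgh; apply: (extremalM pp Hc Hv).
Qed.

Lemma edge_gcd_dvd p f s l : (l.+1 < size s)%N ->
  (edge_gcd p f s %| edge_width p f (nth 0%N s l) (nth 0%N s l.+1))%N.
Proof.
move=> lt; have lt' : (l < (size s).-1)%N by case: (size s) lt.
by rewrite /edge_gcd big_mkord; apply: (biggcdn_inf (Ordinal lt')).
Qed.

(* Every edge of [f] splits into an edge of [g] and an edge of [h] of the same
   slope, one of which may be reduced to a point; as the slopes increase, these
   edges of [g] are contiguous. *)
Lemma edge_gcd_dvd_size p (f g h : {poly int}) (c : int) s : prime p ->
  f`_0 != 0 -> (0 < (size f).-1)%N -> newton_abscissae p f s ->
  c != 0 -> c%:P * f = g * h -> (edge_gcd p f s %| (size g).-1)%N.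
Proof.
move=> pp f0 n0 sP c0 cfgh.
have memP j := mem_newton_abscissae j f0 n0 sP.
have [srt _] := sP.
have sz0 : (0 < size s)%N.
  by have /memP := right_vertex0 p f0; case: (s).
have nth_le i k : (k < size s)%N -> (i <= k)%N -> (nth 0%N s i <= nth 0%N s k)%N.
  move=> ks; rewrite leq_eqVlt => /orP[/eqP->//|ik]; apply: ltnW.
  by apply: (sorted_ltn_nth ltn_trans) => //; rewrite inE (ltn_trans ik).
(* Invariant: the [l]-th vertex of [f] is the sum of right ends in [g] and [h] for one common slope,
   and the part in [g] is divisible by the gcd. *)
have step l : (l < size s)%N -> exists mu a b,
    [/\ extremal p (-1) mu f (nth 0%N s l), extremal p (-1) mu g a,
        extremal p (-1) mu h b, (a + b)%N = nth 0%N s l & (edge_gcd p f s %| a)%N].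
  elim: l => [_|l IHl lt].
    have s0 : nth 0%N s 0 = 0%N.
      have /memP /(nthP 0%N)[i ilt i0] := right_vertex0 p f0.
      by apply/eqP; rewrite -leqn0 -[X in (_ <= X)%N]i0; apply: nth_le.
    have [mu H0] := right_vertex0 p f0.
    have [a [b [Ha Hb ab]]] := extremal_split pp (isT : -1 != 0 :> rat) c0 cfgh H0.
    exists mu, a, b; rewrite s0; split=> //.
    by move/eqP: ab; rewrite addn_eq0 => /andP[/eqP-> _]; rewrite dvdn0.
  have [mu [a [b [Hf Ha Hb ab Da]]]] := IHl (ltnW lt).
  have [lts [lam [Hf1 Hf2]]] := newton_abscissae_face f0 n0 sP lt.
  have mulam : mu < lam.
    have := proj2 Hf _ (proj1 Hf2); rewrite (gtn_eqF lts) => /(_ isT).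
    have e := extremal_wt_eq Hf1 Hf2.
    have ltr : 0 < (nth 0%N s l.+1)%:R - (nth 0%N s l)%:R :> rat by rewrite subr_gt0 ltr_nat.
    rewrite /wt => lt_wt; rewrite -subr_gt0 -(pmulr_lgt0 _ ltr); move: lt_wt.
    by case=> [|[_]]; lra.
  have [a1 [b1 [Ha1 Hb1 ab1]]] := extremal_split pp (isT : 1 != 0 :> rat) c0 cfgh Hf1.
  have [a2 [b2 [Ha2 Hb2 ab2]]] := extremal_split pp (isT : -1 != 0 :> rat) c0 cfgh Hf2.
  exists lam, a2, b2; split=> //.
  have aa1 := extremal_mono Ha Ha1 mulam; have bb1 := extremal_mono Hb Hb1 mulam.
  (* Here [a <= a1] and [b <= b1], while both sums equal the same vertex. *)
  have a1E : a1 = a by lia.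
  have [le_a wdvd] := face_width_dvd lts Hf1 Hf2 Ha1 Ha2.
  rewrite -(subnK le_a) dvdn_add //; last by rewrite a1E.
  exact: dvdn_trans (edge_gcd_dvd p f lt) wdvd.
have lt_last : ((size s).-1 < size s)%N by rewrite prednK.
have [mu [a [b [Hf Ha Hb ab Da]]]] := step _ lt_last.
suff <- : a = (size g).-1 by [].
(* The last vertex is at least deg f = deg g + deg h, whereas [a] and [b] are at most deg g and deg
   h. *)
have sn : ((size f).-1 <= nth 0%N s (size s).-1)%N.
  have /memP /(nthP 0%N)[i ilt <-] := right_vertex_size p f0 n0.
  by apply: nth_le => //; rewrite -ltnS prednK.
have := coef_neq0_lt (proj1 Ha); have := coef_neq0_lt (proj1 Hb).
have neq0 (q : {poly int}) i : q`_i != 0 -> q != 0.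
  by apply: contraNneq => ->; rewrite coef0.
have szf : size f = (size g + size h).-1.
  have := size_mul (neq0 _ _ (proj1 Ha)) (neq0 _ _ (proj1 Hb)).
  by rewrite -cfgh mul_polyC size_scale.
by lia.
Qed.

Theorem theoremB (n k : nat) (f : {poly int}) (p : 'I_k -> nat)
    (j : 'I_k -> seq nat) (d : 'I_k -> nat)
    (n_ge1 : (1 <= n)%N) (size_f : size f = n.+1) (f0_neq0 : f`_0 != 0)
    (k_ge2 : (2 <= k)%N)
    (p_prime : forall i, prime (p i)) (p_inj : injective p)
    (j_vertices : forall i, newton_abscissae (p i) f (j i))
    (d_def : forall i, d i = edge_gcd (p i) f (j i)) :
  (forall g : {poly rat}, g %| map_poly intr f ->
     (n %/ \big[gcdn/0%N]_(i < k) (n %/ d i) %| (size g).-1)%N) /\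
  (\big[gcdn/0%N]_(i < k) (n %/ d i) = 1 ->
     irreducible_poly (map_poly intr f : {poly rat}))%N.
Proof.
have n0 : (0 < (size f).-1)%N by rewrite size_f.
have size_intr (q : {poly int}) : size (map_poly intr q : {poly rat}) = size q.
  by rewrite size_map_inj_poly //; apply: intr_inj.
set G := \big[gcdn/0%N]_(i < k) _.
(* The trivial factorisation of [f] as [f * 1] makes the quotients [n %/ d i] exact. *)
have d_dvdn i : (d i %| n)%N.
  have := @edge_gcd_dvd_size (p i) f f 1 1 (j i) (p_prime i) f0_neq0 n0 (j_vertices i).
  by rewrite -d_def size_f; apply; rewrite // mulrC.
have G_dvd i : (G %| n %/ d i)%N by apply: (biggcdn_inf i).
have G_dvdn : (G %| n)%N.
  by apply: (dvdn_trans (G_dvd (Ordinal k_ge2))); apply: dvdn_div.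
have G_gt0 : (0 < G)%N := dvdn_gt0 n_ge1 G_dvdn.
have degP (g : {poly rat}) : g %| map_poly intr f -> (n %/ G %| (size g).-1)%N.
  move=> /dvdpP[h fhg].
  (* Clearing denominators is what introduces the constant [c] of the integral factorisation. *)
  have [g' [a a0 gE]] := rat_poly_scale g; have [h' [b b0 hE]] := rat_poly_scale h.
  have ab0 : a * b != 0 by rewrite mulf_neq0.
  have abf : (a * b)%:P * f = g' * h'.
    apply: (@map_inj_poly _ _ (intr : int -> rat)); [exact: intr_inj | by [] | ].
    have gE' : map_poly intr g' = a%:~R *: g.
      by rewrite gE scalerA mulfV ?scale1r // intr_eq0.
    have hE' : map_poly intr h' = b%:~R *: h.
      by rewrite hE scalerA mulfV ?scale1r // intr_eq0.
    rewrite !rmorphM /= !map_polyC /= fhg gE' hE' -!mul_polyC; ring.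
  have -> : size g = size g'.
    by rewrite gE size_scale ?size_intr // invr_neq0 // intr_eq0.
  (* The claim becomes that [n] divides deg g times [G], the gcd of the deg g * (n / d_i); each of
     these is a multiple of [n] since d_i divides deg g. *)
  rewrite dvdn_divLR // /G (big_morph _ (muln_gcdr _) (muln0 _)).
  apply/dvdn_biggcdP => i _.
  rewrite muln_divA // dvdn_divRL; last by rewrite dvdn_mull.
  rewrite mulnC dvdn_mul // d_def.
  exact: edge_gcd_dvd_size (p_prime i) f0_neq0 n0 (j_vertices i) ab0 abf.
split=> // G1; split; first by rewrite size_intr size_f ltnS.
move=> q q_size q_dvd; have := degP q q_dvd; rewrite -/G in G1; rewrite G1 divn1.
have f0 : map_poly intr f != 0 :> {poly rat} by rewrite -size_poly_gt0 size_intr size_f.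
have q0 : q != 0 by apply: dvdpN0 q_dvd f0.
move=> n_dvd; rewrite -dvdp_size_eqp // size_intr size_f eqn_leq.
have := dvdp_leq f0 q_dvd; rewrite size_intr size_f => -> /=.
move: q0 q_size n_dvd; rewrite -size_poly_gt0.
by case: (size q) => [//|[//|m]] _ _ /=; apply: dvdn_leq.
Qed.
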